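(* Let $(M,g)$ be a smooth oriented Riemannian $2$-manifold with Gauss curvature $K_g<0$ and with $g$ satisfying the Ricci condition $\Delta_g\log|K_g|=4K_g$. Then the entropy differential $P$ of $(M,g)$ is holomorphic.
   Context: $M$ carries the complex structure determined by $g$ and the orientation. Put $u_g=-\frac14\log|K_g|$. The entropy form is the trace-free symmetric $2$-form $$T=-\mathring\nabla^2u_g-3\left(du_g\otimes du_g-\frac12|du_g|_g^2\,g\right),$$ where $\mathring\nabla^2$ is the trace-free Hessian of $g$; equivalently, $T$ is the trace-free Hessian of $\log K_{\hat g}$ with respect to $\hat g=|K_g|^{3/4}g$. The entropy differential $P$ is the quadratic differential of type $(2,0)$ (locally $f\,dz^2$, $z$ a local holomorphic coordinate) with $\operatorname{Re}P=T$. *)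

(* Defs.v *)
From HB Require Import structures.
From mathcomp Require Import all_boot all_order all_algebra.
From mathcomp Require Import complex.
From mathcomp Require Import all_classical all_reals all_analysis.

Set Implicit Arguments.
Unset Strict Implicit.
Unset Printing Implicit Defensive.

Import Order.TTheory GRing.Theory Num.Theory.
Import numFieldNormedType.Exports.

Local Open Scope classical_set_scope.
Local Open Scope ring_scope.
Local Open Scope complex_scope.

Definition partial (R : realType) (i : 'I_2) (f : 'rV[R]_2 -> R) :
  'rV[R]_2 -> R := fun x => 'D_(delta_mx 0 i) f x.

Definition smooth_on (R : realType) (U : set 'rV[R]_2) (f : 'rV[R]_2 -> R) :=
  forall (s : seq 'I_2) (x : 'rV[R]_2), U x ->
    {for x, continuous (foldr (@partial R) f s)} /\
    forall i : 'I_2, derivable (foldr (@partial R) f s) x (delta_mx 0 i).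

(* [cfun] and [cinv] are total functions; only their values on [cdom] and on
   the image of [cdom] are meaningful. *)
Record chart (R : realType) (M : topologicalType) := Chart {
  cdom : set M;
  cfun : M -> 'rV[R]_2;
  cinv : 'rV[R]_2 -> M;
  _ : open cdom;
  _ : open (cfun @` cdom);
  _ : {in cdom, cancel cfun cinv};
  _ : {in cdom, continuous cfun};
  _ : {in cfun @` cdom, continuous cinv}
}.

Definition cimg (R : realType) (M : topologicalType) (phi : chart R M) :
  set 'rV[R]_2 := cfun phi @` cdom phi.

Definition overlap (R : realType) (M : topologicalType) (phi psi : chart R M) :
  set 'rV[R]_2 := cfun phi @` (cdom phi `&` cdom psi).

Definition transition (R : realType) (M : topologicalType)
  (phi psi : chart R M) : 'rV[R]_2 -> 'rV[R]_2 := cfun psi \o cinv phi.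

(* The Jacobian matrix ['J] acts on row vectors from the right, so its (i, k)
   entry is the i-th partial derivative of the k-th coordinate. *)
Definition oriented_compatible (R : realType) (M : topologicalType)
    (phi psi : chart R M) :=
  (forall k : 'I_2,
     smooth_on (overlap phi psi) (fun x => transition phi psi x 0 k)) /\
  (forall x, overlap phi psi x -> 0 < \det ('J (transition phi psi) x)).

(* A smooth structure together with an orientation is a maximal atlas whose
   transition maps are smooth with positive Jacobian determinant. *)
Record oriented_surface (R : realType) := OrientedSurface {
  surface_space : topologicalType;
  surface_hausdorff : hausdorff_space surface_space;
  surface_countable : @second_countable surface_space;
  atlas : set (chart R surface_space);
  atlas_cover : forall p, exists2 phi, atlas phi & cdom phi p;
  atlas_compatible : forall phi psi, atlas phi -> atlas psi ->
    oriented_compatible phi psi;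
  atlas_maximal : forall phi,
    (forall psi, atlas psi ->
       oriented_compatible phi psi /\ oriented_compatible psi phi) ->
    atlas phi
}.

(* A field of (real or complex valued) bilinear forms is given by its
   components in every chart: the value on tangent vectors with components
   v, w is v *m B *m w^T. *)
Definition is_bilinear_field (R : realType) (M : oriented_surface R)
    (A : comPzRingType) (c : R -> A)
    (B : chart R (surface_space M) -> 'rV[R]_2 -> 'M[A]_2) :=
  forall phi psi, atlas phi -> atlas psi ->
  forall x, overlap phi psi x ->
    let J := map_mx c ('J (transition phi psi) x) in
    B phi x = J *m B psi (transition phi psi x) *m J^T.

Record riemannian_metric (R : realType) (M : oriented_surface R) := Metric {
  metric :> chart R (surface_space M) -> 'rV[R]_2 -> 'M[R]_2;
  metric_bilinear : is_bilinear_field id metric;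
  metric_smooth : forall phi, atlas phi ->
    forall i j : 'I_2, smooth_on (cimg phi) (fun x => metric phi x i j);
  metric_sym : forall phi, atlas phi ->
    forall x, cimg phi x -> (metric phi x)^T = metric phi x;
  metric_pos : forall phi, atlas phi -> forall x, cimg phi x ->
    forall v : 'rV[R]_2, v != 0 -> 0 < (v *m metric phi x *m v^T) 0 0
}.

Section Local.
(* [G] is the matrix of components of the metric in a chart. *)
Variables (R : realType) (G : 'rV[R]_2 -> 'M[R]_2).
Implicit Types (u : 'rV[R]_2 -> R) (x : 'rV[R]_2) (i j k l m : 'I_2).

(* Gamma^k_{ij} *)
Definition christoffel k i j x : R :=
  2^-1 * \sum_l invmx (G x) k l *
    (partial i (fun y => G y j l) x + partial j (fun y => G y i l) x
     - partial l (fun y => G y i j) x).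

(* R(e_i, e_j) e_k = \sum_l (riemann l i j k) e_l, with
   R(X, Y) = nabla_X nabla_Y - nabla_Y nabla_X - nabla_[X, Y]. *)
Definition riemann l i j k x : R :=
  partial i (christoffel l j k) x - partial j (christoffel l i k) x
  + \sum_m (christoffel m j k x * christoffel l i m x
            - christoffel m i k x * christoffel l j m x).

(* g(R(e_0, e_1) e_1, e_0) / (g(e_0, e_0) g(e_1, e_1) - g(e_0, e_1)^2) *)
Definition gauss_curvature x : R :=
  (\sum_l riemann l 0 1 1 x * G x l 0) / \det (G x).

Definition hessian u x : 'M[R]_2 :=
  \matrix_(i, j) (partial i (partial j u) x
                  - \sum_k christoffel k i j x * partial k u x).

Definition trace_g x (B : 'M[R]_2) : R := \tr (invmx (G x) *m B).

Definition laplacian u x : R := trace_g x (hessian u x).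

Definition tracefree_hessian u x : 'M[R]_2 :=
  hessian u x - (2^-1 * laplacian u x) *: G x.

Definition du_du u x : 'M[R]_2 := \matrix_(i, j) (partial i u x * partial j u x).

Definition normsq_du u x : R := trace_g x (du_du u x).

Definition log_curvature x : R := ln `|gauss_curvature x|.

Definition entropy_potential x : R := - 4^-1 * log_curvature x.

Definition entropy_form x : 'M[R]_2 :=
  - tracefree_hessian entropy_potential x
  - 3 *: (du_du entropy_potential x
          - (2^-1 * normsq_du entropy_potential x) *: G x).

Definition area_form x : 'M[R]_2 :=
  Num.sqrt (\det (G x)) *: (delta_mx 0 1 - delta_mx 1 0).

(* Rotation by +90 degrees, acting on row vectors from the right and determined
   by g(JX, Y) = area_form(X, Y). *)
Definition complex_structure x : 'M[R]_2 := area_form x *m invmx (G x).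

End Local.

Definition zcoord (R : realType) (x : 'rV[R]_2) : R[i] := x 0 0 +i* x 0 1.

(* Components of dz = dx + i dy and of dz^2 = dz (x) dz in the coordinates
   (x, y). *)
Definition dz (R : realType) : 'cV[R[i]]_2 :=
  \col_i (if i == 0 then 1 else 'i).

Definition dz2 (R : realType) : 'M[R[i]]_2 := dz R *m (dz R)^T.

(* A local holomorphic coordinate z = x + i y is a chart (x, y) of the atlas in
   which dz(JX) = i dz(X). Every local diffeomorphism z with this property
   preserves orientation, so it belongs to the (maximal, oriented) atlas. *)
Definition holomorphic_chart (R : realType) (M : oriented_surface R)
    (g : riemannian_metric M) (phi : chart R (surface_space M)) :=
  atlas phi /\ forall x, cimg phi x ->
    map_mx (real_complex R) (complex_structure (g phi) x) *m dz R
    = 'i *: dz R.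

Definition is_quadratic_differential (R : realType) (M : oriented_surface R)
    (g : riemannian_metric M)
    (P : chart R (surface_space M) -> 'rV[R]_2 -> 'M[R[i]]_2) :=
  is_bilinear_field (real_complex R) P /\
  forall phi, holomorphic_chart g phi ->
    exists f : R[i] -> R[i],
      forall x, cimg phi x -> P phi x = f (zcoord x) *: dz2 R.

Definition is_entropy_differential (R : realType) (M : oriented_surface R)
    (g : riemannian_metric M)
    (P : chart R (surface_space M) -> 'rV[R]_2 -> 'M[R[i]]_2) :=
  is_quadratic_differential g P /\
  forall phi, atlas phi -> forall x, cimg phi x ->
    map_mx (@complex.Re R) (P phi x) = entropy_form (g phi) x.

Definition holomorphic_on (R : realType) (D : set R[i]) (f : R[i] -> R[i]) :=
  forall z, D z -> derivable (f : R[i]^o -> R[i]^o) z 1.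

Definition is_holomorphic_differential (R : realType) (M : oriented_surface R)
    (g : riemannian_metric M)
    (P : chart R (surface_space M) -> 'rV[R]_2 -> 'M[R[i]]_2) :=
  forall phi, holomorphic_chart g phi ->
    exists2 f : R[i] -> R[i], holomorphic_on (@zcoord R @` cimg phi) f &
      forall x, cimg phi x -> P phi x = f (zcoord x) *: dz2 R.

Definition negative_curvature (R : realType) (M : oriented_surface R)
    (g : riemannian_metric M) :=
  forall phi, atlas phi -> forall x, cimg phi x ->
    gauss_curvature (g phi) x < 0.

Definition ricci_condition (R : realType) (M : oriented_surface R)
    (g : riemannian_metric M) :=
  forall phi, atlas phi -> forall x, cimg phi x ->
    laplacian (g phi) (log_curvature (g phi)) x
    = 4 * gauss_curvature (g phi) x.

(* Main.v *)
(* In a holomorphic chart the metric is [lam (dx^2 + dy^2)].  With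
   [s_i = d_i lam / (2 lam)] and [u] the entropy potential,
     K = - (d_0 s_0 + d_1 s_1) / lam   and   d_i K = - 4 K d_i u,
   and the Ricci condition reads [u_00 + u_11 = - lam K = d_0 s_0 + d_1 s_1].
   The entropy differential is [(T_00 - i T_01) dz^2] with
     T_00 = - (u_00 - u_11) / 2 + s_0 u_0 - s_1 u_1 - 3/2 (u_0^2 - u_1^2),
     T_01 = - u_01 + s_1 u_0 + s_0 u_1 - 3 u_0 u_1.
   Differentiating [u_00 + u_11 = - lam K] once expresses the gradient of the
   Laplacian of [u] through lower-order terms, and the Cauchy-Riemann equations
   for [T_00 - i T_01] follow from the symmetry of second derivatives. *)

Require Import Defs.
From mathcomp Require Import all_boot all_order all_algebra.
From mathcomp Require Import complex.
From mathcomp Require Import all_classical all_reals all_analysis.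
From mathcomp Require Import ring lra.

Set Implicit Arguments.
Unset Strict Implicit.
Unset Printing Implicit Defensive.

Import Order.TTheory GRing.Theory Num.Theory.
Import numFieldNormedType.Exports.

Local Open Scope classical_set_scope.
Local Open Scope ring_scope.
Local Open Scope complex_scope.

(** * Calculus of partial derivatives in the plane *)

Section Lines.
Variables (R : realType) (V : normedModType R).
Implicit Types (f : V -> R) (x v a : V) (h t : R).

(** The difference quotients of the two functions coincide, so one-variable calculus applies to
    directional derivatives. *)
Lemma is_derive_line f x v t : derivable f (t *: v + x) v ->
  is_derive t 1 (fun s => f (s *: v + x)) ('D_v f (t *: v + x)).
Proof.
move=> df.
have E : (fun h => h^-1 *: (((fun s => f (s *: v + x)) \o shift t) (h *: 1) -
      f (t *: v + x))) =
    (fun h => h^-1 *: ((f \o shift (t *: v + x)) (h *: v) - f (t *: v + x))).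
  by apply/funext => h /=; rewrite [h%:A]mulr1 scalerDl addrA.
by split; rewrite /derivable /derive E.
Qed.

Lemma derivable_shift_point f a x v :
  derivable f (a + x) v -> derivable (fun y => f (a + y)) x v.
Proof.
have E : (fun h => h^-1 *: (((fun y => f (a + y)) \o shift x) (h *: v) -
      f (a + x))) =
    (fun h => h^-1 *: ((f \o shift (a + x)) (h *: v) - f (a + x))).
  by apply/funext => h /=; rewrite addrCA.
by rewrite /derivable E.
Qed.

Lemma derive_shift_point f a x v :
  'D_v (fun y => f (a + y)) x = 'D_v f (a + x).
Proof.
have E : (fun h => h^-1 *: (((fun y => f (a + y)) \o shift x) (h *: v) -
      f (a + x))) =
    (fun h => h^-1 *: ((f \o shift (a + x)) (h *: v) - f (a + x))).
  by apply/funext => h /=; rewrite addrCA.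
by rewrite /derive E.
Qed.

(** The one-variable mean value theorem on the segment between [0] and [h]. Bounding [c] by absolute
    values makes the statement uniform in the sign of [h]. *)
Lemma MVT_line f x v h :
  (forall c, `|c| <= `|h| -> derivable f (c *: v + x) v) ->
  exists2 c, `|c| <= `|h| & f (h *: v + x) - f x = 'D_v f (c *: v + x) * h.
Proof.
move=> df; pose g s := f (s *: v + x).
have dg (c : R) : `|c| <= `|h| -> is_derive c 1 g ('D_v f (c *: v + x)).
  by move=> /df; exact: is_derive_line.
have g0 : g 0 = f x by rewrite /g scale0r add0r.
have [h0|h0] := leP 0 h.
- have sub c : c \in `[0, h]%R -> `|c| <= `|h|.
    by rewrite in_itv /= => /andP[c0 ch]; rewrite !ger0_norm.
  have [||c /sub hc E] := @MVT_segment R g (fun c => 'D_v f (c *: v + x)) 0 h h0.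
  + by move=> c ch; apply/dg/sub/subset_itv_oo_cc.
  + by apply: derivable_within_continuous => c /sub /dg [].
  by exists c; rewrite // -g0 E subr0.
- have sub c : c \in `[h, 0]%R -> `|c| <= `|h|.
    rewrite in_itv /= => /andP[ch c0].
    by rewrite (ler0_norm c0) (ltr0_norm h0) lerN2.
  have [||c /sub hc E] := @MVT_segment R g (fun c => 'D_v f (c *: v + x)) h 0 (ltW h0).
  + by move=> c ch; apply/dg/sub/subset_itv_oo_cc.
  + by apply: derivable_within_continuous => c /sub /dg [].
  exists c => //; rewrite -g0; apply/eqP; rewrite -eqr_opp opprB -/(g h) E.
  by rewrite sub0r mulrN.
Qed.

(** The chain rule at [0] for [ln] composed with the restriction of [f] to the line through [x] in
    direction [v]; derivability in that single direction is enough. *)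
Lemma is_derive_ln f x v df : 0 < f x -> is_derive x v f df ->
  is_derive x v (fun y => ln (f y)) (df / f x).
Proof.
move=> f0 [fd <-].
have fl : is_derive (0 : R) 1 (fun s => f (s *: v + x)) ('D_v f x).
  by rewrite -[x in 'D_v f x]add0r -(scale0r v); apply: is_derive_line;
    rewrite scale0r add0r.
have := @is_derive1_comp R (@ln R) (fun s => f (s *: v + x)) 0 (f x)^-1 ('D_v f x).
rewrite scale0r add0r => /(_ (is_derive1_ln f0) fl) [d e].
split; first exact/derivable1P.
have E : (fun h => h^-1 *: (((fun y => ln (f y)) \o shift x) (h *: v) - ln (f x))) =
    (fun h => h^-1 *: (((@ln R \o fun s => f (s *: v + x)) \o shift 0) (h *: 1)
      - (@ln R \o fun s => f (s *: v + x)) 0)).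
  by apply/funext => h /=; rewrite scale0r add0r addr0 [h%:A]mulr1.
by rewrite mulrC -e /derive E.
Qed.

End Lines.

(** * Differentiability classes on open subsets of the plane *)

Section Plane.
Variable R : realType.
Implicit Types (U : set 'rV[R]_2) (f g : 'rV[R]_2 -> R) (x p : 'rV[R]_2).

Notation e i := (delta_mx 0 i : 'rV[R]_2).

Lemma norm_delta_rv (i : 'I_2) : `|e i| <= 1.
Proof.
(* The norm is the maximum of the absolute values of the entries; when nonzero it is attained at
   some entry [k]. *)
change (mx_norm (e i) <= 1); have [->|/mx_norm_neq0[k ->]] := eqVneq (mx_norm (e i)) 0.
  exact: ler01.
by rewrite mxE; case: (_ && _); rewrite ?normr1 ?normr0.
Qed.

Lemma ball_deltas p (i j : 'I_2) (a b r : R) :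
  `|a| + `|b| < r -> ball p r (b *: e j + (a *: e i + p)).
Proof.
move=> abr; rewrite -ball_normE /= distrC addrA addrK.
apply: le_lt_trans abr; rewrite addrC; apply: le_trans (ler_normD _ _) _.
by rewrite !normrZ; apply: lerD; rewrite ler_piMr // norm_delta_rv.
Qed.

(** The left side is the increment along [e i] of [f (h *: e j + y) - f y]. One mean value theorem
    in direction [e i] produces an increment of [partial i f], and a second one in direction [e j]
    produces the mixed derivative. *)
Lemma second_difference f (i j : 'I_2) p (h : R) :
  (forall c d, `|c| <= `|h| -> `|d| <= `|h| ->
     derivable f (d *: e j + (c *: e i + p)) (e i) /\
     derivable (partial i f) (d *: e j + (c *: e i + p)) (e j)) ->
  exists c d, [/\ `|c| <= `|h|, `|d| <= `|h| &
    f (h *: e j + (h *: e i + p)) - f (h *: e i + p)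
      - (f (h *: e j + p) - f p)
    = partial j (partial i f) (d *: e j + (c *: e i + p)) * h * h].
Proof.
move=> H; pose g y := f (h *: e j + y) - f y.
have d1 c : `|c| <= `|h| -> derivable (fun y => f (h *: e j + y)) (c *: e i + p) (e i).
  by move=> ch; apply: derivable_shift_point; have [] := H c h ch (lexx _).
have d2 c : `|c| <= `|h| -> derivable f (c *: e i + p) (e i).
  by move=> ch; have := H c 0 ch; rewrite normr0 normr_ge0 scale0r add0r => /(_ isT)[].
have [|c ch E] := @MVT_line R _ g p (e i) h.
  by move=> c ch; exact: derivableB (d1 c ch) (d2 c ch).
have [|d dh F] := @MVT_line R _ (partial i f) (c *: e i + p) (e j) h.
  by move=> d dh; have [] := H c d ch dh.
exists c, d; split=> //; rewrite -/(g (h *: e i + p)) -/(g p) E.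
rewrite (deriveB (d1 c ch) (d2 c ch) : 'D_(e i) g _ = _).
by rewrite derive_shift_point -[X in X * h = _]/(partial i f _ - partial i f _) F.
Qed.

(* Derivatives of order [n] are also required to be partially differentiable,
   so this sits between C^n and C^(n+1). *)
Fixpoint Ck (n : nat) U f : Prop :=
  (forall x, U x -> {for x, continuous f} /\ forall i, derivable f x (e i)) /\
  (if n is m.+1 then forall i, Ck m U (partial i f) else True).

Lemma Ck_cont n U f x : Ck n U f -> U x -> {for x, continuous f}.
Proof. by case: n => [|n] [H _] /H[]. Qed.

Lemma Ck_derivable n U f x i : Ck n U f -> U x -> derivable f x (e i).
Proof. by case: n => [|n] [H _] /H[]. Qed.
Arguments Ck_derivable {n U f x} i.

Lemma Ck_partial n U f i : Ck n.+1 U f -> Ck n U (partial i f).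
Proof. by case=> _; apply. Qed.
Arguments Ck_partial {n U f} i.

Lemma CkS n U f : Ck n.+1 U f -> Ck n U f.
Proof.
elim: n f => [|n IH] f [H1 H2]; split=> // i.
by apply: IH; exact: H2.
Qed.

Lemma Ck_smooth n U f : smooth_on U f -> Ck n U f.
Proof.
elim: n f => [|n IH] f sf; split=> //.
- by move=> x; exact: (sf [::]).
- by move=> x; exact: (sf [::]).
by move=> i; apply: IH => s; rewrite -foldr_rcons; exact: sf.
Qed.

Lemma open_near U x : open U -> U x -> \forall y \near x, U y.
Proof. by move=> oU Ux; exact: open_nbhs_nbhs. Qed.

Lemma partial_eq U f g i x : open U -> (forall y, U y -> f y = g y) -> U x ->
  partial i f x = partial i g x.
Proof.
move=> oU fg Ux; apply: near_eq_derive.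
by near=> y; apply: fg; near: y; exact: open_near.
Unshelve. all: by end_near. Qed.

(** The sum, product and quotient rules give derivatives only on [U]. This transfers regularity
    along such formulas, since on an open set continuity and derivatives depend only on nearby
    values. *)
Lemma Ck_eq n U f g : open U -> (forall x, U x -> f x = g x) ->
  Ck n U f -> Ck n U g.
Proof.
move=> oU; have C0 m f' g' x : (forall x, U x -> f' x = g' x) -> Ck m U f' ->
    U x -> {for x, continuous g'} /\ forall i, derivable g' x (e i).
  move=> fg Cf Ux; have nfg : \forall y \near x, f' y = g' y.
    by near=> y; apply: fg; near: y; exact: open_near.
  split=> [|i]; last exact: near_eq_derivable nfg (Ck_derivable i Cf Ux).
  rewrite /prop_for /continuous_at -(fg x Ux).
  exact: cvg_trans (near_eq_cvg nfg) (Ck_cont Cf Ux).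
elim: n f g => [|n IH] f g fg Cf; split=> //; try by move=> x; exact: C0 fg Cf.
by move=> i; apply: IH (Ck_partial i Cf) => x; exact: partial_eq oU fg.
Unshelve. all: by end_near. Qed.

Lemma partialD n U f g i x : Ck n U f -> Ck n U g -> U x ->
  partial i (fun y => f y + g y) x = partial i f x + partial i g x.
Proof.
by move=> Cf Cg Ux; exact: deriveD (Ck_derivable i Cf Ux) (Ck_derivable i Cg Ux).
Qed.
Arguments partialD {n U f g} i {x}.

Lemma partialM n U f g i x : Ck n U f -> Ck n U g -> U x ->
  partial i (fun y => f y * g y) x = f x * partial i g x + g x * partial i f x.
Proof.
by move=> Cf Cg Ux; exact: deriveM (Ck_derivable i Cf Ux) (Ck_derivable i Cg Ux).
Qed.
Arguments partialM {n U f g} i {x}.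

Lemma partialZ n U f (k : R) i x : Ck n U f -> U x ->
  partial i (fun y => k * f y) x = k * partial i f x.
Proof.
by move=> Cf Ux; exact: deriveZ (Ck_derivable i Cf Ux).
Qed.
Arguments partialZ {n U f k} i {x}.

Lemma partialV n U f i x : Ck n U f -> U x -> f x != 0 ->
  partial i (fun y => (f y)^-1) x = - (f x)^-1 ^+ 2 * partial i f x.
Proof.
move=> Cf Ux f0; rewrite exprVn.
exact: deriveV f0 (Ck_derivable i Cf Ux).
Qed.
Arguments partialV {n U f} i {x}.

Lemma partial_ln n U f i x : Ck n U f -> U x -> 0 < f x ->
  partial i (fun y => ln (f y)) x = partial i f x / f x.
Proof.
move=> Cf Ux f0; apply: derive_val; apply: is_derive_ln => //.
by apply/derivableP; exact: Ck_derivable _ Cf Ux.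
Qed.
Arguments partial_ln {n U f} i {x}.

Lemma Ck_cst n U (k : R) : Ck n U (fun=> k).
Proof.
elim: n k => [|n IH] k; split=> //.
1,2: by move=> x Ux; split=> [|i]; [exact: cst_continuous|exact: derivable_cst].
move=> i; rewrite (_ : partial i _ = fun=> 0); first exact: IH.
by apply/funext => x; rewrite /partial derive_cst.
Qed.

Lemma CkD n U f g : open U -> Ck n U f -> Ck n U g -> Ck n U (fun y => f y + g y).
Proof.
move=> oU; elim: n f g => [|n IH] f g Cf Cg; split=> //.
1,2: by move=> x Ux; split=> [|i];
    [exact: continuousD (Ck_cont Cf Ux) (Ck_cont Cg Ux)
    |exact: derivableD (Ck_derivable i Cf Ux) (Ck_derivable i Cg Ux)].
move=> i; apply: (Ck_eq oU (fun x Ux => esym (partialD i Cf Cg Ux))).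
by apply: IH; exact: Ck_partial _.
Qed.

Lemma CkM n U f g : open U -> Ck n U f -> Ck n U g -> Ck n U (fun y => f y * g y).
Proof.
move=> oU; elim: n f g => [|n IH] f g Cf Cg; split=> //.
1,2: by move=> x Ux; split=> [|i];
    [exact: continuousM (Ck_cont Cf Ux) (Ck_cont Cg Ux)
    |exact: derivableM (Ck_derivable i Cf Ux) (Ck_derivable i Cg Ux)].
move=> i; apply: (Ck_eq oU (fun x Ux => esym (partialM i Cf Cg Ux))).
by apply: CkD => //; apply: IH; first [exact: CkS|exact: Ck_partial _].
Qed.

Lemma CkZ n U f (k : R) : open U -> Ck n U f -> Ck n U (fun y => k * f y).
Proof. by move=> oU Cf; apply: CkM => //; exact: Ck_cst. Qed.

(** The derivative of [1/f] is a product of [- (1/f)^2] and a derivative of [f], so the induction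
    hypothesis on [1/f] itself closes the induction. *)
Lemma CkV n U f : open U -> (forall x, U x -> f x != 0) -> Ck n U f ->
  Ck n U (fun y => (f y)^-1).
Proof.
move=> oU f0; elim: n => [|n IH] Cf; split=> //.
1,2: by move=> x Ux; split=> [|i];
    [exact: cvgV (f0 x Ux) (Ck_cont Cf Ux)
    |exact: derivableV (f0 x Ux) (Ck_derivable i Cf Ux)].
move=> i.
apply: (Ck_eq (f := fun x => (-1 * ((f x)^-1 * (f x)^-1)) * partial i f x) oU).
  by move=> x Ux; rewrite (partialV i Cf Ux (f0 x Ux)) mulN1r expr2.
apply: CkM => //; last exact: Ck_partial _.
by apply: CkZ => //; apply: CkM => //; apply: IH; exact: CkS.
Qed.

Lemma Ck_ln n U f : open U -> (forall x, U x -> 0 < f x) -> Ck n U f ->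
  Ck n U (fun y => ln (f y)).
Proof.
move=> oU f0; case: n => [|n] Cf; split=> //.
1,2: move=> x Ux; split=> [|i]; [apply: continuous_comp;
       [exact: Ck_cont Cf Ux|by apply: continuous_ln; exact: f0]|].
1,2: by have /derivableP d := Ck_derivable i Cf Ux; have [] := is_derive_ln (f0 x Ux) d.
move=> i; apply: (Ck_eq oU (fun x Ux => esym (partial_ln i Cf Ux (f0 x Ux)))).
apply: CkM => //; first exact: Ck_partial _.
by apply: CkV => //; [move=> x Ux; rewrite gt_eqF // f0|exact: CkS].
Qed.

(** * Symmetry of second derivatives and first-order expansion *)

Lemma continuous_near f p (eps : R) : {for p, continuous f} -> 0 < eps ->
  \forall y \near p, `|f p - f y| <= eps.
Proof. by move=> /cvgr_dist_le; apply. Qed.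

Lemma ler_dist_half (s t u eps : R) :
  `|s - u| <= eps / 2 -> `|t - u| <= eps / 2 -> `|s - t| <= eps.
Proof. by rewrite !ler_norml => /andP[? ?] /andP[? ?]; apply/andP; lra. Qed.

(** The second difference of [f] is symmetric in [i] and [j]. Evaluating it in both orders equates
    the two mixed derivatives at two points near [p], and continuity at [p] brings them within any
    [eps] of each other. *)
Lemma partialC n U f (i j : 'I_2) p : open U -> Ck n.+2 U f -> U p ->
  partial i (partial j f) p = partial j (partial i f) p.
Proof.
move=> oU Cf Up; apply/eqP; rewrite eq_sym -subr_eq0 -normr_le0.
apply/ler_addgt0Pr => eps eps0; rewrite add0r.
have cij := Ck_cont (Ck_partial i (Ck_partial j Cf)) Up.
have cji := Ck_cont (Ck_partial j (Ck_partial i Cf)) Up.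
have e2 : 0 < eps / 2 by rewrite divr_gt0.
have : \forall y \near p, [/\ U y,
   `|partial i (partial j f) p - partial i (partial j f) y| <= eps / 2 &
   `|partial j (partial i f) p - partial j (partial i f) y| <= eps / 2].
  apply: filterS3 (open_near oU Up) (continuous_near cij e2)
    (continuous_near cji e2) => y Uy yij yji.
  by split.
move=> /nbhs_ballP[r /= r0 B].
(* Each of the two displacements is at most [r / 3], so their sum stays below the radius [r]. *)
pose h := r / 3; have h0 : 0 < h by rewrite divr_gt0.
have inB k l c d : `|c| <= `|h| -> `|d| <= `|h| ->
    ball p r (d *: e l + (c *: e k + p)).
  move=> ch dh; apply: ball_deltas; apply: le_lt_trans (lerD ch dh) _.
  by rewrite gtr0_norm // /h; lra.
have [|c [d [ch dh E]]] := @second_difference f i j p h.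
  move=> c d ch dh; have [Uy _ _] := B _ (inB i j c d ch dh).
  by split; [exact: Ck_derivable _ Cf Uy|exact: Ck_derivable _ (Ck_partial i Cf) Uy].
have [|c' [d' [ch' dh' E']]] := @second_difference f j i p h.
  move=> x y xh yh; have [Uy _ _] := B _ (inB j i x y xh yh).
  by split; [exact: Ck_derivable _ Cf Uy|exact: Ck_derivable _ (Ck_partial j Cf) Uy].
have [_ _ B1] := B _ (inB i j c d ch dh).
have [_ B2 _] := B _ (inB j i c' d' ch' dh').
set y := d *: _ + _ in E B1; set y' := d' *: _ + _ in E' B2.
have {E E'} : partial j (partial i f) y = partial i (partial j f) y'.
  have hn0 : h != 0 by rewrite gt_eqF.
  apply: (mulIf hn0); apply: (mulIf hn0).
  (* The two second differences are the same four values grouped differently. *)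
  have swap (s t u v : R) : s - t - (u - v) = s - u - (t - v) by ring.
  have PE : h *: e i + (h *: e j + p) = h *: e j + (h *: e i + p) := addrCA _ _ _.
  rewrite PE swap in E'.
  exact: etrans (esym E) E'.
move=> EE; rewrite EE in B1.
exact: ler_dist_half B1 B2.
Unshelve. all: by end_near. Qed.
Arguments partialC {n U f} i j {p}.

(** Go from [p] to the target first along [e 0], then along [e 1]. The mean value theorem on each
    leg gives a partial derivative at a point near [p], hence within [eps] of its value at [p]. *)
Lemma C1_first_order n U f p (eps : R) : open U -> Ck n.+1 U f -> U p -> 0 < eps ->
  exists2 r : R, 0 < r & forall a b, `|a| < r -> `|b| < r ->
    U (b *: e 1 + (a *: e 0 + p)) /\
    `|f (b *: e 1 + (a *: e 0 + p)) - f p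
       - (a * partial 0 f p + b * partial 1 f p)| <= eps * (`|a| + `|b|).
Proof.
move=> oU Cf Up eps0.
have c0 := Ck_cont (Ck_partial 0 Cf) Up.
have c1 := Ck_cont (Ck_partial 1 Cf) Up.
have : \forall y \near p, [/\ U y,
   `|partial 0 f p - partial 0 f y| <= eps &
   `|partial 1 f p - partial 1 f y| <= eps].
  apply: filterS3 (open_near oU Up) (continuous_near c0 eps0)
    (continuous_near c1 eps0) => y Uy y0 y1.
  by split.
move=> /nbhs_ballP[r /= r0 B]; exists (r / 2) => [|a b ar br].
  by rewrite divr_gt0.
have inB c d : `|c| <= `|a| -> `|d| <= `|b| ->
    ball p r (d *: e 1 + (c *: e 0 + p)).
  by move=> ch dh; apply: ball_deltas; lra.
have inB0 c : `|c| <= `|a| -> ball p r (c *: e 0 + p).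
  move=> ca; have := inB c 0 ca; rewrite scale0r add0r; apply.
  by rewrite normr0.
split; first by have [] := B _ (inB a b (lexx _) (lexx _)).
have [|c ca Ec] := @MVT_line R _ f p (e 0) a.
  by move=> c /inB0 /B [Uy _ _]; exact: Ck_derivable _ Cf Uy.
have [|d db Ed] := @MVT_line R _ f (a *: e 0 + p) (e 1) b.
  by move=> d db; have [Uy _ _] := B _ (inB a d (lexx _) db);
    exact: Ck_derivable _ Cf Uy.
have [_ B0 _] := B _ (inB0 c ca).
have [_ _ B1] := B _ (inB a d (lexx _) db).
rewrite (_ : _ - _ = (partial 1 f (d *: e 1 + (a *: e 0 + p)) - partial 1 f p) * b
   + (partial 0 f (c *: e 0 + p) - partial 0 f p) * a); last first.
  by rewrite /partial in Ec Ed *; rewrite !mulrBl -Ec -Ed; ring.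
apply: le_trans (ler_normD _ _) _; rewrite !normrM mulrDr addrC.
by apply: lerD; apply: ler_wpM2r => //; rewrite distrC.
Unshelve. all: by end_near. Qed.

End Plane.

(** * The Cauchy-Riemann equations *)

Section Holo.
Variable R : realType.
Implicit Types (U : set 'rV[R]_2) (p q : 'rV[R]_2 -> R) (x : 'rV[R]_2).

Lemma normc_le (a b : R) : `|a +i* b| <= (`|a| + `|b|)%:C.
Proof.
rewrite normc_def /= lecR -[leRHS]ger0_norm ?addr_ge0 // -sqrtr_sqr.
rewrite ler_sqrt ?sqr_ge0 // sqrrD !real_normK ?num_real //.
by rewrite lerD2r lerDl mulrn_wge0 // mulr_ge0.
Qed.

(** With [normc_le], this compares the modulus with the sum of absolute values in which
    [C1_first_order] is stated; the factor 2 is absorbed later. *)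
Lemma norm_ReIm_le (a b : R) : (`|a| + `|b|)%:C <= 2%:C * `|a +i* b|.
Proof.
rewrite normc_def /= -rmorphM lecR mulr2n mulrDl !mul1r.
by apply: lerD; rewrite -sqrtr_sqr ler_sqrt ?addr_ge0 ?sqr_ge0 // ?lerDl ?lerDr sqr_ge0.
Qed.

Lemma zcoordD (a b : R) x :
  zcoord (b *: delta_mx 0 1 + (a *: delta_mx 0 0 + x)) = (a +i* b) + zcoord x.
Proof.
by rewrite /zcoord !mxE /= !mulr1 !mulr0 !add0r; simpc.
Qed.

(** By the Cauchy-Riemann equations, the real linear parts of [p] and [q] combine into
    multiplication by the complex number [l], so the first-order errors of [p] and [q] are the two
    components of the error of [f]. *)
Lemma cauchy_riemann_holomorphic n U p q (f : R[i] -> R[i]) :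
  open U -> Ck n.+1 U p -> Ck n.+1 U q ->
  (forall x, U x -> f (zcoord x) = p x +i* q x) ->
  (forall x, U x -> partial 0 p x = partial 1 q x) ->
  (forall x, U x -> partial 1 p x = - partial 0 q x) ->
  holomorphic_on (@zcoord R @` U) f.
Proof.
move=> oU Cp Cq fE CR0 CR1 _ [x Ux <-].
pose l : R[i]^o := partial 0 p x +i* partial 0 q x.
apply/cvg_ex; exists l; apply/cvgrPdist_le => eps eps0.
have [r [r0 epsE]] : exists r, 0 < r /\ eps = r%:C.
  exists (complex.Re eps); move: eps0; case: eps => a b.
  by rewrite ltcE /= => /andP[/eqP -> ->].
(* Two errors of size [r / 4] add up to [r / 2], and [norm_ReIm_le] costs a factor 2, which leaves
   exactly [r]. *)
have e4 : 0 < r / 4 by rewrite divr_gt0.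
have [d1 d10 P1] := C1_first_order oU Cp Ux e4.
have [d2 d20 P2] := C1_first_order oU Cq Ux e4.
have dC : 0 < (Num.min d1 d2)%:C :> R[i] by rewrite ltcR lt_min d10.
near=> h.
have h0 : h != 0 by near: h; exact: nbhs_dnbhs_neq.
have hd : `|h| < (Num.min d1 d2)%:C by near: h; exact: dnbhs0_lt.
have [a [b hE]] : exists a b, h = a +i* b by case: (h) => a b; exists a, b.
rewrite {}hE in h0 hd *.
have ad : `|a| < Num.min d1 d2.
  by rewrite -ltcR; apply: le_lt_trans hd; exact: (normc_ge_Re (a +i* b)).
have bd : `|b| < Num.min d1 d2.
  rewrite -ltcR; apply: le_lt_trans hd; rewrite normc_def lecR -sqrtr_sqr.
  by rewrite ler_sqrt ?addr_ge0 ?sqr_ge0 // lerDr sqr_ge0.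
move: ad bd; rewrite !lt_min => /andP[a1 a2] /andP[b1 b2].
have [Uy Ep] := P1 a b a1 b1; have [_ Eq] := P2 a b a2 b2.
(* Both expansions now involve only the derivatives along [e 0], which are the components of [l]. *)
rewrite -CR0 // in Eq; rewrite CR1 // in Ep.
have hn0 : 0 < `|a +i* b| by rewrite normr_gt0.
rewrite -(ler_pM2r hn0) -normrM epsE.
have -> : (f \o shift (zcoord x)) ((a +i* b) *: (1 : R[i]^o)) =
    f (zcoord (b *: delta_mx 0 1 + (a *: delta_mx 0 0 + x))).
  by rewrite /= zcoordD [_ *: _]mulr1.
rewrite !fE // mulrBl.
rewrite [X in _ - X * _](mulrC (a +i* b)^-1) mulfVK -?normr_gt0 // -[X in X <= _]normrN.
rewrite opprB.
set P := _ - _ - _ in Ep; set Q := _ - _ - _ in Eq.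
rewrite (_ : _ - l * _ = P +i* Q); last first.
  by rewrite /l /P /Q; simpc; congr (_ +i* _); ring.
apply: le_trans (normc_le _ _) _; apply: (@le_trans _ _ ((r / 2) * (`|a| + `|b|))%:C).
  rewrite lecR; apply: le_trans (lerD Ep Eq) _; rewrite -mulrDl.
  by rewrite (_ : r / 4 + r / 4 = r / 2) //; field.
rewrite rmorphM; apply: le_trans (_ : (r / 2)%:C * (2%:C * `|a +i* b|) <= _).
  by apply: ler_wpM2l (norm_ReIm_le a b); rewrite lecR divr_ge0 // ltW.
by rewrite mulrA -rmorphM divfK.
Unshelve. all: by end_near. Qed.

End Holo.

(** * Conformal metrics satisfying the Ricci condition *)

Lemma sum_ord2 (A : nmodType) (F : 'I_2 -> A) : \sum_i F i = F 0 + F 1.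
Proof. by rewrite !big_ord_recl big_ord0 addr0; congr (_ + F _); exact: val_inj. Qed.

Lemma ord2_ind (Q : 'I_2 -> Prop) : Q 0 -> Q 1 -> forall i, Q i.
Proof.
move=> Q0 Q1 i; case: (unliftP 0 i) => [j ->|-> //].
by rewrite (_ : lift 0 j = 1) //; apply: val_inj; rewrite /= (ord1 j).
Qed.

(** * First derivatives of composite expressions *)

Section Gradient.
Variables (R : realType) (U : set 'rV[R]_2).
Hypothesis oU : open U.
Implicit Types (f g : 'rV[R]_2 -> R) (df dg : 'I_2 -> 'rV[R]_2 -> R).

(** Regularity and derivative formulas are kept together because each closure rule needs the
    regularity of its arguments to differentiate them. *)
Definition gradient f df :=
  (forall n, Ck n U f) /\ forall i x, U x -> partial i f x = df i x.

Lemma gradient_partial f : (forall n, Ck n U f) -> gradient f (fun i => partial i f).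
Proof. by move=> Cf; exact: conj Cf (fun i x _ => erefl). Qed.

Lemma gradientD f df g dg : gradient f df -> gradient g dg ->
  gradient (fun x => f x + g x) (fun i x => df i x + dg i x).
Proof.
move=> [Cf fE] [Cg gE]; split=> [n|i x Ux]; first exact: CkD.
by rewrite (partialD i (Cf 0) (Cg 0) Ux) fE // gE.
Qed.

Lemma gradientM f df g dg : gradient f df -> gradient g dg ->
  gradient (fun x => f x * g x) (fun i x => f x * dg i x + g x * df i x).
Proof.
move=> [Cf fE] [Cg gE]; split=> [n|i x Ux]; first exact: CkM.
by rewrite (partialM i (Cf 0) (Cg 0) Ux) fE // gE.
Qed.

Lemma gradientZ f df (k : R) : gradient f df ->
  gradient (fun x => k * f x) (fun i x => k * df i x).
Proof.
move=> [Cf fE]; split=> [n|i x Ux]; first exact: CkZ.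
by rewrite (partialZ k i (Cf 0) Ux) fE.
Qed.

End Gradient.

(* Abstracting the atoms keeps [ring] and [field] from comparing them up to
   conversion, which does not terminate in practice. *)
Ltac abstract_at x :=
  repeat match goal with |- context [?f x] =>
    let r := fresh "r" in generalize (f x); intro r
  end.
Ltac ring_at x := abstract_at x; ring.
Ltac field_at x := abstract_at x; intros; field.

(** * Connection and curvature of a conformal metric *)

Section Conformal.
Variables (R : realType) (U : set 'rV[R]_2) (G : 'rV[R]_2 -> 'M[R]_2).
Implicit Types (u v : 'rV[R]_2 -> R) (x : 'rV[R]_2) (i j k l m : 'I_2).

Variable lam : 'rV[R]_2 -> R.
Hypotheses (oU : open U) (GE : forall x, U x -> G x = (lam x)%:M)
  (lam0 : forall x, U x -> 0 < lam x) (Clam : forall n, Ck n U lam).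

Let slope i x := 2^-1 * ((lam x)^-1 * partial i lam x).

Let lamn0 x (Ux : U x) : lam x != 0. Proof. by rewrite gt_eqF // lam0. Qed.

Let invGE x : U x -> invmx (G x) = ((lam x)^-1)%:M.
Proof. by move=> Ux; rewrite GE // invmx_scalar. Qed.

Let Cslope n i : Ck n U (slope i).
Proof.
apply: CkZ => //; apply: CkM => //; last exact: Ck_partial.
by apply: CkV => //; exact: lamn0.
Qed.

Let partial_lam i x : U x -> partial i lam x = 2 * lam x * slope i x.
Proof. by move=> /lamn0; rewrite /slope; field_at x. Qed.

(** The slopes are the partial derivatives of half the logarithm of [lam], so this is the symmetry
    of second derivatives. *)
Let slopeC x : U x -> partial 1 (slope 0) x = partial 0 (slope 1) x.
Proof.
move=> Ux; have n0 := lamn0 Ux.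
have E i j : partial j (slope i) x = 2^-1 * ((lam x)^-1 * partial j (partial i lam) x
    + partial i lam x * (- (lam x)^-1 ^+ 2 * partial j lam x)).
  have CV : Ck 0 U (fun y => (lam y)^-1) by apply: CkV => //; exact: lamn0.
  have Cp : Ck 0 U (partial i lam) by exact: Ck_partial.
  rewrite (partialZ _ j (CkM oU CV Cp) Ux) (partialM j CV Cp Ux).
  by rewrite (partialV j (Clam 0) Ux n0).
by rewrite !E (partialC 1 0 oU (Clam 2) Ux); ring_at x.
Qed.

Let partial_G i j k x : U x ->
  partial k (fun y => G y i j) x = (i == j)%:R * partial k lam x.
Proof.
move=> Ux; rewrite -(partialZ _ k (Clam 0) Ux).
by apply: (partial_eq _ oU _ Ux) => y Uy; rewrite GE // mxE mulr_natl.
Qed.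

(** The inverse metric is diagonal, so only the summand [l = k] survives. *)
Let christoffelE k i j x : U x -> christoffel G k i j x =
  (j == k)%:R * slope i x + (i == k)%:R * slope j x - (i == j)%:R * slope k x.
Proof.
move=> Ux; rewrite /christoffel (bigD1 k) //= big1 => [|l lk]; last first.
  by rewrite invGE // mxE eq_sym (negPf lk) mul0r.
rewrite invGE // mxE eqxx mulr1n /slope.
by rewrite (partial_G j k i Ux) (partial_G i k j Ux) (partial_G i j k Ux); ring_at x.
Qed.

(** In dimension two the Christoffel terms cancel in the trace: the symbols with lower indices [0 0]
    and [1 1] are opposite. *)
Lemma laplacian_conformal v x : U x ->
  laplacian G v x = (partial 0 (partial 0 v) x + partial 1 (partial 1 v) x) / lam x.
Proof.
move=> Ux; rewrite /laplacian /trace_g invGE // mul_scalar_mx mxtraceZ /mxtrace.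
rewrite sum_ord2 !mxE !sum_ord2 !christoffelE //=; ring_at x.
Qed.

(** The quadratic Christoffel terms cancel, and the two differentiated symbols are [- slope 0] and
    [slope 1]. *)
Lemma gauss_curvature_conformal x : U x ->
  gauss_curvature G x = - (partial 0 (slope 0) x + partial 1 (slope 1) x) / lam x.
Proof.
move=> Ux; have n0 := lamn0 Ux.
rewrite /gauss_curvature sum_ord2 GE // det_scalar !mxE /= mulr0n mulr0 addr0 mulr1n.
rewrite /riemann sum_ord2 !christoffelE //=.
have -> : partial 0 (christoffel G 0 1 1) x = - 1 * partial 0 (slope 0) x.
  rewrite -(partialZ _ 0 (Cslope 0 0) Ux); apply: (partial_eq _ oU _ Ux) => y Uy.
  by rewrite christoffelE //=; ring_at y.
have -> : partial 1 (christoffel G 0 0 1) x = partial 1 (slope 1) x.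
  by apply: (partial_eq _ oU _ Ux) => y Uy; rewrite christoffelE //=; ring.
by move: n0; field_at x.
Qed.

(** * Curvature and entropy potential under the Ricci condition *)

Hypotheses (Kneg : forall x, U x -> gauss_curvature G x < 0)
  (ricci : forall x, U x ->
     laplacian G (log_curvature G) x = 4 * gauss_curvature G x).

Let K := gauss_curvature G.
Let u := entropy_potential G.

Let CK n : Ck n U K.
Proof.
apply: (Ck_eq (f := fun x => -1 * (partial 0 (slope 0) x + partial 1 (slope 1) x)
                             * (lam x)^-1) oU) => [x Ux|].
  by rewrite /K gauss_curvature_conformal // mulN1r.
apply: CkM => //; last by apply: CkV => //; exact: lamn0.
by apply: CkZ => //; apply: CkD => //; exact: (Ck_partial _ (Cslope n.+1 _)).
Qed.

(** Writing [-1 * K] lets the rules for scalar multiples also handle negation; the same convention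
    is used below. *)
Let CNK n : Ck n U (fun x => -1 * K x). Proof. exact: CkZ. Qed.

Let NK0 x : U x -> 0 < -1 * K x.
Proof. by move=> Ux; rewrite mulN1r oppr_gt0; exact: Kneg. Qed.

Let uE x : U x -> - 4^-1 * ln (-1 * K x) = u x.
Proof.
move=> Ux; rewrite /u /entropy_potential /log_curvature mulN1r.
by rewrite ltr0_norm //; exact: Kneg.
Qed.

Let Cu n : Ck n U u.
Proof. by apply: (Ck_eq oU uE); apply: CkZ => //; exact: Ck_ln. Qed.

Let partial_K i x : U x -> partial i K x = - 4 * K x * partial i u x.
Proof.
move=> Ux; have K0 : K x != 0 by rewrite lt_eqF // Kneg.
rewrite -(partial_eq i oU uE Ux) (partialZ _ i (Ck_ln oU NK0 (CNK 0)) Ux).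
rewrite (partial_ln i (CNK 0) Ux (NK0 Ux)) (partialZ _ i (CK 0) Ux).
by move: K0; field_at x.
Qed.

Let laplacian_u x : U x ->
  partial 0 (partial 0 u) x + partial 1 (partial 1 u) x = - (lam x * K x).
Proof.
move=> Ux; have := ricci Ux; rewrite laplacian_conformal //.
have E i : partial i (partial i (log_curvature G)) x
    = - 4 * partial i (partial i u) x.
  rewrite -(partialZ _ i (Ck_partial i (Cu 1)) Ux).
  apply: (partial_eq _ oU _ Ux) => y Uy; rewrite -(partialZ _ i (Cu 0) Uy).
  by apply: (partial_eq _ oU _ Uy) => z Uz; rewrite /u /entropy_potential; field_at z.
rewrite !E => /(congr1 ( *%R^~ (lam x))); rewrite divfK ?lamn0 // -/(K x) => H.
apply: (mulfI (_ : - 4 != 0 :> R)); first by rewrite oppr_eq0 pnatr_eq0.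
by rewrite mulrDr H; ring_at x.
Qed.

Let laplacian_slope x : U x ->
  partial 0 (slope 0) x + partial 1 (slope 1) x = - (lam x * K x).
Proof.
by move=> Ux; rewrite /K gauss_curvature_conformal //; move: (lamn0 Ux); field_at x.
Qed.

(** The logarithmic derivatives of [lam] and [K] are [2 * slope i] and [- 4 * partial i u], so
    differentiating their product brings in only first-order quantities. *)
Let partial_laplacian_u i x : U x ->
  partial i (partial 0 (partial 0 u)) x + partial i (partial 1 (partial 1 u)) x
  = - (lam x * K x) * (2 * slope i x - 4 * partial i u x).
Proof.
move=> Ux.
have C2 j : Ck 0 U (partial j (partial j u)).
  exact: (Ck_partial _ (Ck_partial _ (Cu 2))).
rewrite -(partialD i (C2 0) (C2 1) Ux).
have E y : U y -> partial 0 (partial 0 u) y + partial 1 (partial 1 u) y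
    = -1 * (lam y * K y) by move=> Uy; rewrite laplacian_u // mulN1r.
rewrite (partial_eq i oU E Ux) (partialZ _ i (CkM oU (Clam 0) (CK 0)) Ux).
by rewrite (partialM i (Clam 0) (CK 0) Ux) partial_K // partial_lam //; ring_at x.
Qed.

Definition entropy_re x : R :=
  - 2^-1 * (partial 0 (partial 0 u) x + -1 * partial 1 (partial 1 u) x)
  + (slope 0 x * partial 0 u x + -1 * (slope 1 x * partial 1 u x))
  + - (3 / 2) * (partial 0 u x * partial 0 u x + -1 * (partial 1 u x * partial 1 u x)).

(** This is the negative of the [0 1] entry of the entropy form: that entry of [dz2] is the
    imaginary unit, and the real part of ['i * f] is minus the imaginary part of [f]. *)
Definition entropy_im x : R :=
  partial 0 (partial 1 u) x
  + -1 * (slope 1 x * partial 0 u x + slope 0 x * partial 1 u x)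
  + 3 * (partial 0 u x * partial 1 u x).

Lemma entropy_form_re x : U x -> entropy_form G x 0 0 = entropy_re x.
Proof.
move=> Ux; have n0 := lamn0 Ux.
rewrite /entropy_form /tracefree_hessian /normsq_du -/u.
rewrite laplacian_conformal // /trace_g invGE // mul_scalar_mx mxtraceZ /mxtrace.
rewrite sum_ord2 GE // !mxE sum_ord2 !christoffelE //= /entropy_re.
by move: n0; field_at x.
Qed.

Lemma entropy_form_im x : U x -> entropy_form G x 0 1 = - entropy_im x.
Proof.
move=> Ux; have n0 := lamn0 Ux.
rewrite /entropy_form /tracefree_hessian /normsq_du -/u.
rewrite laplacian_conformal // /trace_g invGE // mul_scalar_mx mxtraceZ /mxtrace.
rewrite sum_ord2 GE // !mxE sum_ord2 !christoffelE //= /entropy_im.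
by move: n0; field_at x.
Qed.

(** * The Cauchy-Riemann equations for the entropy differential *)

Let Gs i : gradient U (slope i) (fun j => partial j (slope i)).
Proof. exact: (gradient_partial (fun n => Cslope n i)). Qed.

Let Gu i : gradient U (partial i u) (fun j => partial j (partial i u)).
Proof. exact: (gradient_partial (fun n => Ck_partial i (Cu n.+1))). Qed.

Let Guu i j :
  gradient U (partial i (partial j u)) (fun k => partial k (partial i (partial j u))).
Proof.
exact: (gradient_partial (fun n => Ck_partial i (Ck_partial j (Cu n.+2)))).
Qed.

(** The term follows the syntax of [entropy_re], so its function is that definition up to
    conversion, and its second component supplies the differentiated expression. *)
Let gradient_re :=
  gradientD oU
    (gradientD oU
      (gradientZ oU (- 2^-1)
        (gradientD oU (Guu 0 0) (gradientZ oU (-1) (Guu 1 1))))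
      (gradientD oU (gradientM oU (Gs 0) (Gu 0))
        (gradientZ oU (-1) (gradientM oU (Gs 1) (Gu 1)))))
    (gradientZ oU (- (3 / 2))
      (gradientD oU (gradientM oU (Gu 0) (Gu 0))
        (gradientZ oU (-1) (gradientM oU (Gu 1) (Gu 1))))).

Let gradient_im :=
  gradientD oU
    (gradientD oU (Guu 0 1)
      (gradientZ oU (-1)
        (gradientD oU (gradientM oU (Gs 1) (Gu 0)) (gradientM oU (Gs 0) (Gu 1)))))
    (gradientZ oU 3 (gradientM oU (Gu 0) (Gu 1))).

Lemma Ck_entropy_re n : Ck n U entropy_re.
Proof. exact: (gradient_re.1 n). Qed.

Lemma Ck_entropy_im n : Ck n U entropy_im.
Proof. exact: (gradient_im.1 n). Qed.

Let u_mixed i x : U x -> partial i (partial 1 (partial 0 u)) x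
  = partial i (partial 0 (partial 1 u)) x.
Proof.
by apply: (partial_eq _ oU) => y Uy; exact: (partialC 1 0 oU (Cu 2) Uy).
Qed.

Lemma entropy_cauchy_riemann x : U x ->
  partial 0 entropy_re x = partial 1 entropy_im x /\
  partial 1 entropy_re x = - partial 0 entropy_im x.
Proof.
move=> Ux.
rewrite (gradient_re.2 0 x Ux) (gradient_re.2 1 x Ux).
rewrite (gradient_im.2 0 x Ux) (gradient_im.2 1 x Ux).
have := partialC 1 0 oU (Cu 2) Ux.
have := partialC 1 0 oU (Ck_partial 1 (Cu 3)) Ux.
have := partialC 1 0 oU (Ck_partial 0 (Cu 3)) Ux; have := u_mixed 0 Ux.
have := slopeC Ux; have := laplacian_slope Ux; have := laplacian_u Ux.
have := partial_laplacian_u 0 Ux; have := partial_laplacian_u 1 Ux.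
(* The values at [x] become independent variables, and [subst] uses up the equations that commute
   derivatives. *)
cbv beta; abstract_at x => E0 E1 Eu Es *; subst.
(* [Eu] eliminates the product of [lam] and [K]. Each remaining relation is solved for its second
   summand: two third derivatives of [u], and the derivative of [slope 1] along [e 1]. What is left
   are identities in free variables. *)
rewrite -Eu in E0 E1 Es; move: E0 E1 Es => /(canRL (addKr _)) ->.
by move=> /(canRL (addKr _)) -> /(canRL (addKr _)) ->; split; field.
Qed.

End Conformal.

(** * Holomorphic charts *)

(** As [J] is real, the real and imaginary parts of each entry of the equation give the two entries
    of the corresponding row. *)
Lemma complex_linear_rotation (R : realType) (J : 'M[R]_2) :
  map_mx (real_complex R) J *m dz R = 'i *: dz R ->
  J = delta_mx 0 1 - delta_mx 1 0.
Proof.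
move=> H; have E i := congr1 (fun A : 'cV_2 => A i 0) H.
move: (E 0) (E 1); rewrite !mxE !sum_ord2 !mxE /=; simpc.
move=> [J00 J01] [J10 J11]; apply/matrixP => i j.
by elim/ord2_ind: i; elim/ord2_ind: j; rewrite !mxE /= ?J00 ?J01 ?J10 ?J11;
  rewrite ?subr0 ?sub0r ?oppr0.
Qed.

(** Multiplying the rotation identity by [G x] shows that the rotation times [G x] is the area form.
    Entrywise, the off-diagonal entries of [G x] vanish and both diagonal ones equal the square root
    of its determinant. *)
Lemma conformal_of_complex_structure (R : realType) (G : 'rV[R]_2 -> 'M[R]_2) x :
  G x \in unitmx ->
  map_mx (real_complex R) (complex_structure G x) *m dz R = 'i *: dz R ->
  G x = (G x 0 0)%:M.
Proof.
move=> uG /complex_linear_rotation E.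
have := congr1 (fun A => A *m G x) E; rewrite /complex_structure mulmxKV // /area_form.
move=> H; have {}E i j := congr1 (fun A : 'M[R]_2 => A i j) H.
move: (E 0 0) (E 0 1) (E 1 0) (E 1 1).
rewrite !mxE !sum_ord2 !mxE /= => H1 H2 H3 H4; apply/matrixP => i j.
by elim/ord2_ind: i; elim/ord2_ind: j; rewrite !mxE /=; lra.
Qed.

Lemma unitmx_pos_def (R : realType) n (A : 'M[R]_n) :
  (forall v : 'rV_n, v != 0 -> 0 < (v *m A *m v^T) 0 0) -> A \in unitmx.
Proof.
move=> pos; rewrite -row_free_unit -kermx_eq0; apply/rowV0P => v /sub_kermxP vA.
by apply/eqP/negP => /negP /pos; rewrite vA mul0mx mxE ltxx.
Qed.

Theorem theorem2p1 (R : realType) (M : oriented_surface R)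
    (g : riemannian_metric M)
    (P : chart R (surface_space M) -> 'rV[R]_2 -> 'M[R[i]]_2) :
  negative_curvature g ->
  ricci_condition g ->
  is_entropy_differential g P ->
  is_holomorphic_differential g P.
Proof.
move=> neg ricci [[_ quad] ReP] phi hphi.
have [aphi conf] := hphi; have [f fE] := quad phi hphi.
pose U := cimg phi; pose lam x := g phi x 0 0.
have oU : open U by rewrite /U /cimg; case: (phi).
have pos x : U x -> forall v : 'rV_2, v != 0 -> 0 < (v *m g phi x *m v^T) 0 0.
  exact: metric_pos.
have GE x : U x -> g phi x = (lam x)%:M.
  move=> Ux; apply: conformal_of_complex_structure (conf x Ux).
  exact: unitmx_pos_def (pos x Ux).
have lam0 x : U x -> 0 < lam x.
  move=> Ux; have d0 : (delta_mx 0 0 : 'rV[R]_2) != 0.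
    by apply/negP => /eqP/matrixP/(_ 0 0)/eqP; rewrite !mxE oner_eq0.
  have := pos x Ux _ d0; rewrite -rowE mxE (bigD1 0) //= big1 => [|i /negPf i0].
    by rewrite !mxE /= mulr1 addr0.
  by rewrite !mxE i0 andbF mulr0.
have Clam n : Ck n U lam by apply: Ck_smooth; exact: metric_smooth.
have K0 x : U x -> gauss_curvature (g phi) x < 0 by exact: neg.
have ric x : U x -> laplacian (g phi) (log_curvature (g phi)) x
    = 4 * gauss_curvature (g phi) x by exact: ricci.
(* The coefficient comes from [P] being a quadratic differential; its holomorphy remains. *)
exists f => //.
(* The [0 0] and [0 1] entries of the real part of [f dz^2] are the real part of [f] and minus its
   imaginary part. *)
have fz x : U x -> f (zcoord x) = entropy_re (g phi) lam x +i* entropy_im (g phi) lam x.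
  move=> Ux; have := ReP phi aphi x Ux; rewrite fE // => /matrixP H.
  have := H 0 0; have := H 0 1.
  rewrite (entropy_form_re oU GE lam0 Clam) // (entropy_form_im oU GE lam0 Clam) //.
  move: (entropy_re _ _ _) (entropy_im _ _ _) => p q.
  rewrite !mxE !big_ord1 !mxE /=; case: (f _) => a b; simpc => /=.
  by move=> /oppr_inj <- <-.
have CR := entropy_cauchy_riemann oU GE lam0 Clam K0 ric.
apply: (cauchy_riemann_holomorphic oU _ _ fz).
- exact: (Ck_entropy_re oU GE lam0 Clam K0 1).
- exact: (Ck_entropy_im oU GE lam0 Clam K0 1).
- by move=> x /CR[].
- by move=> x /CR[].
Qed.
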